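(* If $M$ is a compact length space which has at least one closed geodesic, and $k=\mathrm{minind}(M)$, then $$\inf L(M)\ge\min\{\,k\,\mathrm{injrad}(M),\ \inf L_{1/k}(M)\,\}.$$
   Context: A compact length space is a compact metric space in which every pair of points is joined by a rectifiable curve whose length equals the distance between the points. A geodesic segment is a locally length minimizing curve; it is minimal if its length equals the distance between its endpoints. The injectivity radius is $\mathrm{injrad}(M)=\sup\{t:\text{ any geodesic segment of length } t \text{ in } M \text{ is minimal}\}$ (taken to be $0$ if there is no such $t>0$). $S^1=\mathbb{R}/2\pi\mathbb{Z}$. A closed geodesic in $M$ is a nonconstant map $\gamma:S^1\to M$ that is locally length minimizing around every point of $S^1$, parametrized proportionally to arclength with speed $L(\gamma)/(2\pi)$, where $L(\gamma)$ is its length. The length spectrum $L(M)$ is the set of lengths of closed geodesics in $M$. A $1/k$ geodesic is a closed geodesic $\gamma$ with $d(\gamma(t),\gamma(t+2\pi/k))=L(\gamma)/k$ for all $t\in S^1$. $L_{1/k}(M)$ is the set of lengths of $1/k$ geodesics. The minimizing index $\mathrm{minind}(\gamma)$ of a closed geodesic $\gamma$ is the smallest $k\in\mathbb{N}$ such that $\gamma$ is a $1/k$ geodesic (such a $k$ always exists). The minimizing index $\mathrm{minind}(M)$ is the smallest $k$ such that $M$ has a closed geodesic of minimizing index $k$. *)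

(* Defs.v *)
From HB Require Import structures.
From mathcomp Require Import all_boot all_order all_algebra.
From mathcomp Require Import all_classical all_reals all_analysis.

Set Implicit Arguments.
Unset Strict Implicit.
Unset Printing Implicit Defensive.

Import Order.TTheory GRing.Theory Num.Theory.
Import numFieldNormedType.Exports.

Local Open Scope classical_set_scope.
Local Open Scope ring_scope.
Local Open Scope ereal_scope.

(* The default value 0 is only taken when [A] is empty. *)
Definition smallest (A : set nat) : nat :=
  xget 0%N [set k | A k /\ forall j, A j -> (k <= j)%N].

Section curves.
Context {R : realType} {M : metricType R}.
Implicit Types (a b : R) (g : R -> M).

(* Metric-space version of [variation] and [total_variation]: [itv_partition a b]
   is the set of subdivisions a < s_0 < ... < s_n = b, without the point a. *)
Definition polygonal_length a b g (s : seq R) : R :=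
  let F := g \o nth b (a :: s) in
  (\sum_(0 <= n < size s) mdist (F n) (F n.+1))%R.

Definition curve_length a b g : \bar R :=
  ereal_sup [set (polygonal_length a b g s)%:E | s in itv_partition a b].

Definition rectifiable_curve a b g : Prop :=
  [/\ (a <= b)%R, {within `[a, b], continuous g} & curve_length a b g < +oo].

(* Intended for an interval [D]; around an end point of [D] belonging to [D]
   the condition is one-sided. *)
Definition locally_minimizing (D : set R) g : Prop :=
  {within D, continuous g} /\
  forall t, D t -> exists2 e : R, (0 < e)%R &
    forall s s', D s -> D s' -> ball t e s -> ball t e s' -> (s <= s')%R ->
      curve_length s s' g = (mdist (g s) (g s'))%:E.

Definition geodesic_segment a b g : Prop :=
  (a <= b)%R /\ locally_minimizing `[a, b] g.

Definition minimal a b g : Prop := curve_length a b g = (mdist (g a) (g b))%:E.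

(* A map defined on the circle R / 2 pi Z is represented by its lift to R, a
   2 pi-periodic map. *)
Definition circle_map g : Prop := forall t : R, g (t + 2 * pi)%R = g t.

Definition loop_length g : \bar R := curve_length 0 (2 * pi) g.

Definition closed_geodesic g : Prop :=
  [/\ circle_map g,
      exists s t : R, g s <> g t,
      locally_minimizing setT g
    & forall s t : R, (s <= t)%R ->
        curve_length s t g = (t - s)%:E * (loop_length g * ((2 * pi)^-1)%:E)].

(* The 1/k geodesics, for k >= 1. *)
Definition frac_geodesic (k : nat) g : Prop :=
  [/\ (0 < k)%N,
      closed_geodesic g
    & forall t : R, (mdist (g t) (g (t + 2 * pi / k%:R)%R))%:E
                    = loop_length g * (k%:R^-1)%:E].

Definition minind g : nat := smallest [set k | frac_geodesic k g].

End curves.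

Section spaces.
Context {R : realType}.
Variable M : metricType R.

Definition length_space : Prop :=
  forall x y : M, exists a b (g : R -> M),
    [/\ rectifiable_curve a b g, g a = x, g b = y
      & curve_length a b g = (mdist x y)%:E].

Definition compact_length_space : Prop := compact [set: M] /\ length_space.

(* The supremum of the empty set is -oo, hence the maximum with 0; the value is
   +oo when the set of admissible t is unbounded. *)
Definition injrad : \bar R :=
  maxe 0 (ereal_sup [set t%:E | t in [set t : R | (0 < t)%R /\
    forall a b (g : R -> M), geodesic_segment a b g ->
      curve_length a b g = t%:E -> minimal a b g]]).

Definition length_spectrum : set (\bar R) :=
  [set loop_length g | g in [set g : R -> M | closed_geodesic g]].

Definition frac_length_spectrum (k : nat) : set (\bar R) :=
  [set loop_length g | g in [set g : R -> M | frac_geodesic k g]].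

Definition minind_space : nat :=
  smallest [set minind g | g in [set g : R -> M | closed_geodesic g]].

End spaces.

(* Main.v *)
Require Import Defs.
From HB Require Import structures.
From mathcomp Require Import all_boot all_order all_algebra.
From mathcomp Require Import all_classical all_reals all_analysis.
From mathcomp Require Import ring lra.

Set Implicit Arguments.
Unset Strict Implicit.
Unset Printing Implicit Defensive.

Import Order.TTheory GRing.Theory Num.Theory.
Import numFieldNormedType.Exports.

Local Open Scope classical_set_scope.
Local Open Scope ring_scope.
Local Open Scope ereal_scope.

(** Let g be a closed geodesic of length L. If L >= k injrad(M) the bound
    holds. Otherwise L/k < injrad(M), and it suffices to see that g is a 1/k
    geodesic, for then inf L_{1/k}(M) <= L.

    The set of lengths whose supremum is injrad(M) need not be an interval: a
    short geodesic segment of M may fail to extend to a longer one. The arcs of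
    g do extend, since g can be followed around the circle as many times as
    needed. So choose t0 > L/k such that all geodesic segments of length t0 are
    minimal; every arc of g of length L/k is the initial part of an arc of g of
    length t0, and an initial part of a minimal curve is minimal
    ([minimal_initial_arc]). This makes the arcs of length L/k minimal, which is
    the definition of a 1/k geodesic ([frac_geodesic_of_lt_injrad]). *)

Section curve_length.
Context {R : realType} {M : metricType R}.
Implicit Types (a b c : R) (g : R -> M).

(** The trivial subdivision of an interval already measures the distance of the
    end points. *)
Lemma mdist_le_curve_length a b g : (a <= b)%R ->
  (mdist (g a) (g b))%:E <= curve_length a b g.
Proof.
rewrite le_eqVlt => /predU1P[<-|ab]; apply: ereal_sup_ubound.
  exists [::]; first by split.
  by rewrite /polygonal_length big_geq// mdistxx.
exists [:: b]; first by split; rewrite //= ab.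
by rewrite /polygonal_length big_nat1.
Qed.

(** If a shortcut existed between the ends of the initial arc, following it and
    then the rest of the curve would beat the distance of the end points. *)
Lemma minimal_initial_arc a b c g : (a <= c)%R -> (c <= b)%R ->
  curve_length a b g = curve_length a c g + curve_length c b g ->
  minimal a b g -> minimal a c g.
Proof.
rewrite /minimal => ac cb ->.
have := mdist_le_curve_length g ac; have := mdist_le_curve_length g cb.
have := metric_triangle (g a) (g c) (g b).
case: (curve_length a c g) => [x| |]; case: (curve_length c b g) => [y| |] //=.
rewrite -EFinD !lee_fin => tri ley lex [] exy.
by congr (_%:E); lra.
Qed.

Lemma locally_minimizing_subset (D D' : set R) g : D `<=` D' ->
  locally_minimizing D' g -> locally_minimizing D g.
Proof.
move=> DD' [cg lg]; split; first exact: continuous_subspaceW cg.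
move=> t /DD' /lg[e e0 He]; exists e => // s s' /DD' Ds /DD' Ds'.
exact: He.
Qed.

End curve_length.

Section closed_geodesics.
Context {R : realType} {M : metricType R}.
Implicit Types (g : R -> M) (k : nat).

Lemma loop_length_ge0 g : 0 <= loop_length g.
Proof.
apply: le_trans (mdist_le_curve_length g _); first by rewrite lee_fin mdist_ge0.
by rewrite mulr_ge0 ?pi_ge0.
Qed.

(** At speed 0 all arcs have length 0, so the curve would be constant. *)
Lemma loop_length_gt0 g : closed_geodesic g -> 0 < loop_length g.
Proof.
move=> [_ [s [t gst]] _ speed]; rewrite lt_neqAle loop_length_ge0 andbT.
apply/negP => /eqP L0; apply: gst.
wlog st : s t / (s <= t)%R.
  by move=> H; case/orP: (le_total s t) => /H // ->.
have := mdist_le_curve_length g st.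
rewrite speed// -L0 mul0e mule0 lee_fin => d0.
by apply/mdist_positivity/eqP; rewrite eq_le d0 mdist_ge0.
Qed.

(** An arc of length L/k is enlarged to one whose length t0 is in the set defining
    the injectivity radius. Such an arc exists for every t0 because [g] is
    periodic and, by [loop_length_gt0], has positive speed. *)
Lemma frac_geodesic_of_lt_injrad k g : (0 < k)%N -> closed_geodesic g ->
  loop_length g < k%:R%:E * injrad M -> frac_geodesic k g.
Proof.
move=> k0 gg Linj; split=> // t.
have := loop_length_gt0 gg; case: (gg) => _ _ lming speed.
case EL : (loop_length g) Linj speed => [L| |] //; last by rewrite ltNge leey.
move=> Linj speed; rewrite lte_fin => L0.
have kR0 : (0 < k%:R :> R)%R by rewrite ltr0n.
have pi0 := pi_gt0 R.
have {}speed s u : (s <= u)%R ->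
    curve_length s u g = ((u - s) * (L / (2 * pi)))%:E.
  by move=> su; rewrite speed.
have [t0 [t00 t0P] Lt0] : exists2 t0 : R, ((0 < t0)%R /\
    forall a b (h : R -> M), geodesic_segment a b h ->
      curve_length a b h = t0%:E -> minimal a b h) & (L / k%:R < t0)%R.
  have : (L / k%:R)%:E < injrad M.
    by rewrite EFinM lte_pdivrMr// muleC.
  rewrite /injrad lt_max lte_fin [X in X || _]ltNge divr_ge0 ?ltW//=.
  by move=> /ereal_sup_gt[_ [t0 t0P <-]]; rewrite lte_fin; exists t0.
(* The time in which [g] travels the distance [t0]. *)
pose c : R := (2 * pi * t0 / L)%R.
have kc : (2 * pi / k%:R <= c)%R.
  rewrite /c -[(_ * t0 / L)%R]mulrA ler_pM2l ?mulr_gt0//.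
  by rewrite ler_pdivlMr// mulrC ltW.
have k20 : (0 <= 2 * pi / k%:R :> R)%R by rewrite divr_ge0 ?mulr_ge0 ?ltW.
have c0 : (t <= t + c)%R by rewrite lerDl (le_trans k20).
have arc_min : minimal t (t + c) g.
  apply: t0P.
    by split=> //; exact: locally_minimizing_subset lming.
  rewrite speed//; congr (_%:E); rewrite /c.
  move: (pi : R) (lt0r_neq0 pi0) (lt0r_neq0 L0) => p p_neq0 L_neq0.
  by field; rewrite p_neq0.
have tk : (t <= t + 2 * pi / k%:R)%R by rewrite lerDl.
have kcD : (t + 2 * pi / k%:R <= t + c)%R by rewrite lerD2l.
have frac_arc_min : minimal t (t + 2 * pi / k%:R) g.
  apply: minimal_initial_arc arc_min => //.
  by rewrite !speed// -EFinD; congr (_%:E); ring.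
apply: etrans (esym frac_arc_min) _; rewrite speed// -EFinM;
congr (_%:E).
move: (pi : R) (lt0r_neq0 pi0) (lt0r_neq0 kR0) => p p_neq0 k_neq0.
by field; rewrite k_neq0.
Qed.

End closed_geodesics.

Theorem theorem6p2 (R : realType) (M : metricType R) (k : nat) :
  compact_length_space M ->
  (exists g : R -> M, closed_geodesic g) ->
  k = minind_space M ->
  mine (k%:R%:E * injrad M) (ereal_inf (frac_length_spectrum M k))
    <= ereal_inf (length_spectrum M).
Proof.
move=> _ _ _; apply: le_ereal_inf_tmp => _ [g gg <-]; rewrite ge_min.
have [//|Linj] := leP (k%:R%:E * injrad M) (loop_length g).
have k0 : (0 < k)%N.
  case: k Linj => // ; rewrite mul0e => L0.
  by have := lt_trans L0 (loop_length_gt0 gg); rewrite ltxx.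
apply: ereal_inf_lbound; exists g => //.
exact: frac_geodesic_of_lt_injrad.
Qed.
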